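(* Let $\widetilde{u}\in\mathcal{G}_{aaa}$. Then there exist $\widetilde{v}\in\mathcal{G}_{aa}$ and $\widetilde{w}\in\mathcal{G}_{+,0}(\mathbb{R})$ such that $\widetilde{u}=\widetilde{v}+\widetilde{w}$ on $\mathbb{J}$, and the decomposition is unique on $\mathbb{J}$; that is, if also $\widetilde{u}=\widetilde{v}'+\widetilde{w}'$ on $\mathbb{J}$ with $\widetilde{v}'\in\mathcal{G}_{aa}$, $\widetilde{w}'\in\mathcal{G}_{+,0}(\mathbb{R})$, then $\widetilde{v}=\widetilde{v}'$ on $\mathbb{J}$ and $\widetilde{w}=\widetilde{w}'$ on $\mathbb{J}$.
   Context: Notation: $\mathbb{Z}_+=\{0,1,2,\dots\}$, $I:=\,]0,1]$, $\mathbb{J}:=[0,+\infty[$, $\mathbb{I}$ is $\mathbb{R}$ or $\mathbb{J}$. All functions are complex-valued. $\mathcal{C}_b$ is the space of bounded continuous functions on $\mathbb{R}$. A continuous function $g$ on $\mathbb{R}$ is almost automorphic if every real sequence $(s_m)$ has a subsequence $(s_{m_k})_k$ such that $\tilde g(x):=\lim_{k}g(x+s_{m_k})$ exists for every $x\in\mathbb{R}$ and $\lim_k\tilde g(x-s_{m_k})=g(x)$ for every $x\in\mathbb{R}$; $\mathcal{C}_{aa}$ is the space of such functions. $\mathcal{C}_{+,0}$ is the space of $h\in\mathcal{C}_b$ with $\lim_{x\to+\infty}h(x)=0$. $\mathcal{C}_{aaa}$ (asymptotically almost automorphic functions) is the space of $f\in\mathcal{C}_b$ for which there are $g\in\mathcal{C}_{aa}$,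 $h\in\mathcal{C}_{+,0}$ with $f=g+h$ on $\mathbb{J}$. $\mathcal{B}(\mathbb{I})$ is the space of smooth functions on $\mathbb{I}$ all of whose derivatives are bounded, with $|\varphi|_{k,\infty,\mathbb{I}}:=\sum_{j\le k}\|\varphi^{(j)}\|_{L^\infty(\mathbb{I})}$. $\mathcal{B}_{aa}$ (resp. $\mathcal{B}_{aaa}$) is the space of smooth functions on $\mathbb{R}$ all of whose derivatives (including order $0$) lie in $\mathcal{C}_{aa}$ (resp. $\mathcal{C}_{aaa}$). $\mathcal{B}_{+,0}(\mathbb{R})$ is the space of $\varphi\in\mathcal{B}(\mathbb{R})$ with $\lim_{x\to+\infty}\varphi^{(j)}(x)=0$ for all $j\in\mathbb{Z}_+$. For a space $X\subset\mathcal{B}(\mathbb{I})$, let $\mathcal{M}_X$ be the set of nets $(u_\varepsilon)_{\varepsilon\in I}\in X^I$ such that $\forall k\in\mathbb{Z}_+\,\exists m\in\mathbb{Z}_+$: $|u_\varepsilon|_{k,\infty,\mathbb{I}}=O(\varepsilon^{-m})$, $\varepsilon\to0$, and $\mathcal{N}_X$ the set of nets in $X^I$ such that $\forall k,m\in\mathbb{Z}_+$: $|u_\varepsilon|_{k,\infty,\mathbb{I}}=O(\varepsilon^{m})$, $\varepsilon\to0$. Set $\mathcal{G}_X:=\mathcal{M}_X/\mathcal{N}_X$. Then $\mathcal{G}_{aaa}$, $\mathcal{G}_{aa}$, $\mathcal{G}_{+,0}(\mathbb{R})$, $\mathcal{G}_{\mathcal{B}}(\mathbb{I})$ are the quotients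 for $X=\mathcal{B}_{aaa},\mathcal{B}_{aa},\mathcal{B}_{+,0}(\mathbb{R}),\mathcal{B}(\mathbb{I})$ respectively; the first three are viewed inside $\mathcal{G}_{\mathcal{B}}(\mathbb{R})$. Restriction to $\mathbb{J}$ is defined on representatives, and an equality between elements of $\mathcal{G}_{\mathcal{B}}(\mathbb{R})$ ''on $\mathbb{J}$'' means equality of the restrictions in $\mathcal{G}_{\mathcal{B}}(\mathbb{J})$. *)

(* Defs.v *)
From HB Require Import structures.
From mathcomp Require Import all_boot all_order all_algebra.
From mathcomp Require Import ring_quotient.
From mathcomp Require Import all_classical all_reals all_analysis.
From mathcomp Require Import ess_sup_inf complex.

Set Implicit Arguments.
Unset Strict Implicit.
Unset Printing Implicit Defensive.

Import Order.TTheory GRing.Theory Num.Theory.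
Import numFieldNormedType.Exports.

Local Open Scope classical_set_scope.
Local Open Scope ring_scope.
Local Open Scope complex_scope.
Local Open Scope quotient_scope.

(* R[i] with the topology given by its modulus. *)
HB.instance Definition _ (R : realType) := NormedModule.copy R[i] R[i]^o.

Variant domain := Line | HalfLine.

Definition dom (R : realType) (I : domain) : set R :=
  match I with Line => setT | HalfLine => `[0, +oo[ end.

(* A function on dom I is encoded by a total function R -> R[i] whose values
   outside dom I are irrelevant: every notion below that is indexed by I
   only looks at the values on dom I. *)

Definition diffq (R : realType) (f : R -> R[i]) (x y : R) : R[i] :=
  (f y - f x) / (y - x)%:C.

(* On HalfLine this is the right derivative at 0. *)
Definition derivI (R : realType) (I : domain) (f : R -> R[i]) (x : R) : R[i] :=
  lim (diffq f x y @[y --> within (dom I) x^']).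

Definition derivnI (R : realType) (I : domain) (k : nat) (f : R -> R[i]) :
  R -> R[i] := iter k (derivI I) f.

Definition smooth (R : realType) (I : domain) : set (R -> R[i]) :=
  [set f | forall k x, dom I x ->
    cvg (diffq (derivnI I k f) x y @[y --> within (dom I) x^'])].

Definition BI (R : realType) (I : domain) : set (R -> R[i]) :=
  [set f | smooth I f /\ forall k, [bounded derivnI I k f x | x in dom I]].

Definition Cb (R : realType) : set (R -> R[i]) :=
  [set f | continuous f /\ bounded_fun f].

Definition Caa (R : realType) : set (R -> R[i]) :=
  [set g | continuous g /\
    forall s : nat -> R, exists (phi : nat -> nat) (gt : R -> R[i]),
      [/\ {homo phi : i j / (i < j)%N},
          forall x, g (x + s (phi k)) @[k --> \oo] --> gt x &
          forall x, gt (x - s (phi k)) @[k --> \oo] --> g x]].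

Definition C0 (R : realType) : set (R -> R[i]) :=
  [set h | Cb h /\ h x @[x --> +oo] --> (0 : R[i])].

Definition Caaa (R : realType) : set (R -> R[i]) :=
  [set f | Cb f /\ exists g h, [/\ Caa g, C0 h &
    forall x, dom HalfLine x -> f x = g x + h x]].

Definition Baa (R : realType) : set (R -> R[i]) :=
  [set f | smooth Line f /\ forall k, Caa (derivnI Line k f)].

Definition Baaa (R : realType) : set (R -> R[i]) :=
  [set f | smooth Line f /\ forall k, Caaa (derivnI Line k f)].

Definition B0 (R : realType) : set (R -> R[i]) :=
  [set f | BI Line f /\
    forall k, derivnI Line k f x @[x --> +oo] --> (0 : R[i])].

Definition Linf (R : realType) (I : domain) (f : R -> R[i]) : \bar R :=
  'N[@lebesgue_measure R]_+oo%E
    [(fun x => (Normc.normc (f x))%:E) \_ (dom I)].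

Definition seminorm (R : realType) (I : domain) (k : nat) (f : R -> R[i]) :
  \bar R := (\sum_(j < k.+1) Linf I (derivnI I j f))%E.

(* The index epsilon ranges over ]0, 1]; the value of a net at a real outside
   ]0, 1] is irrelevant. *)
Definition net (R : realType) := R -> R -> R[i].

HB.instance Definition _ (R : realType) := GRing.Zmodule.on (net R).

Definition nets_in (R : realType) (X : set (R -> R[i])) : set (net R) :=
  [set u | forall e, 0 < e <= 1 -> X (u e)].

Definition moderate (R : realType) (I : domain) (X : set (R -> R[i])) :
  set (net R) :=
  [set u | nets_in X u /\ forall k, exists (m : nat) (K : R),
    \forall e \near (0 : R)^'+, (seminorm I k (u e) <= (K * e ^- m)%:E)%E].

Definition null (R : realType) (I : domain) (X : set (R -> R[i])) :
  set (net R) :=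
  [set u | nets_in X u /\ forall k m : nat, exists K : R,
    \forall e \near (0 : R)^'+, (seminorm I k (u e) <= (K * e ^+ m)%:E)%E].

Lemma null_sub (R : realType) (I : domain) (X : set (R -> R[i])) :
  X `<=` BI I -> null I X = moderate I X `&` null I (BI I).
Proof.
move=> XB; apply/seteqP; split=> u /=.
- move=> [uX Nu]; split; last by split=> // e /uX /XB.
  split=> // k; have [K HK] := Nu k 0%N; exists 0%N, K.
  by apply: filterS HK => e; rewrite !expr0 invr1.
- by move=> [[uX _] [_ Nu]].
Qed.

Section closure.
Variable R : realType.
Implicit Types (I : domain) (f g : R -> R[i]) (x : R).

Lemma within_dom_proper I x : dom I x -> ProperFilter (within (dom I) x^').
Proof.
move=> Ix; apply: Build_ProperFilter_ex => P nP.
suff xP : x^'+ P by exact: (@filter_ex _ _ (at_right_proper_filter x)).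
apply: (filterS (F := nbhs x) _ nP) => y yP xy.
apply: (yP); first by rewrite gt_eqF.
case: I Ix {nP yP} => //=; rewrite !in_itv/= !andbT => x0.
by apply: le_trans x0 _; exact: ltW.
Qed.

Lemma derivnI_cvg I f k x : smooth I f -> dom I x ->
  diffq (derivnI I k f) x y @[y --> within (dom I) x^'] -->
    derivnI I k.+1 f x.
Proof. by move=> sf Ix; exact: sf. Qed.

Lemma lim_diffq I f x (l : R[i]) : dom I x ->
  diffq f x y @[y --> within (dom I) x^'] --> l -> derivI I f x = l.
Proof.
move=> Ix fl; have PF := within_dom_proper Ix.
exact: (cvg_lim (@norm_hausdorff R[i] R[i]) fl).
Qed.

Lemma eq_diffq_cvg I f g x (l : R[i]) : dom I x ->
  (forall y, dom I y -> f y = g y) ->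
  diffq f x y @[y --> within (dom I) x^'] --> l ->
  diffq g x y @[y --> within (dom I) x^'] --> l.
Proof.
move=> Ix fg; apply: cvg_trans; apply: near_eq_cvg.
rewrite near_withinE; near=> y => Iy; rewrite /diffq !fg//.
Unshelve. all: by end_near. Qed.

Lemma diffqB_cvg I f g k x : smooth I f -> smooth I g -> dom I x ->
  diffq (derivnI I k f \- derivnI I k g) x y @[y --> within (dom I) x^'] -->
    derivnI I k.+1 f x - derivnI I k.+1 g x.
Proof.
move=> sf sg Ix; have PF := within_dom_proper Ix.
have df := derivnI_cvg (k := k) sf Ix; have dg := derivnI_cvg (k := k) sg Ix.
apply: cvg_trans; last exact: (@cvgB _ _ _ _ _ _ _ _ _ df dg).
apply: near_eq_cvg; apply: nearW => y /=.
rewrite fctE /diffq -mulrBl; congr (_ / _).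
by rewrite !opprB addrACA [RHS]addrACA; congr (_ + _); rewrite addrC.
Qed.

Lemma derivnIB I f g k x : smooth I f -> smooth I g -> dom I x ->
  derivnI I k (f - g) x = derivnI I k f x - derivnI I k g x.
Proof.
move=> sf sg; elim: k x => // k IHk x Ix.
apply: lim_diffq => //; apply: eq_diffq_cvg (diffqB_cvg sf sg Ix) => // y Iy.
exact: esym (IHk y Iy).
Qed.

Lemma smoothB I f g : smooth I f -> smooth I g -> smooth I (f - g).
Proof.
move=> sf sg k x Ix; apply/cvg_ex; exists (derivnI I k.+1 f x - derivnI I k.+1 g x).
apply: eq_diffq_cvg (diffqB_cvg sf sg Ix) => // y Iy.
by rewrite derivnIB.
Qed.

Lemma BIB I f g : BI I f -> BI I g -> BI I (f - g).
Proof.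
move=> [sf bf] [sg bg]; split; first exact: smoothB.
move=> k; have I0 : dom I (0 : R).
  by case: (I) => //=; rewrite in_itv/= lexx.
have gF := globally_properfilter I0.
have /ex_bound[M1 M1P] := bf k; have /ex_bound[M2 M2P] := bg k.
apply/ex_bound; exists (M1 + M2) => x Ix /=; rewrite derivnIB//.
by rewrite (le_trans (ler_normB _ _))// lerD// ?M1P ?M2P.
Qed.

Lemma derivnI0 I k x : dom I x -> derivnI I k (0 : R -> R[i]) x = 0.
Proof.
elim: k x => // k IHk x Ix; have PF := within_dom_proper Ix.
apply: lim_diffq => //; apply: (@eq_diffq_cvg _ 0) => //.
  by move=> y Iy; exact: esym (IHk y Iy).
rewrite (_ : diffq 0 x = cst 0); first exact: cvg_cst.
by apply/funext => y; rewrite /diffq subrr mul0r.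
Qed.

Lemma BI0 I : BI I (0 : R -> R[i]).
Proof.
split=> k.
  move=> x Ix; have PF := within_dom_proper Ix; apply/cvg_ex; exists 0.
  apply: (@eq_diffq_cvg _ 0) => //; first by move=> y Iy; rewrite derivnI0.
  rewrite (_ : diffq 0 x = cst 0); first exact: cvg_cst.
  by apply/funext => y; rewrite /diffq subrr mul0r.
have I0 : dom I (0 : R) by case: (I) => //=; rewrite in_itv/= lexx.
have gF := globally_properfilter I0.
by apply/ex_bound; exists 0 => x Ix /=; rewrite derivnI0// normr0.
Qed.

Lemma derivnI_half_cvg f k x : smooth Line f -> dom HalfLine x ->
  diffq (derivnI Line k f) x y @[y --> within (dom HalfLine) x^'] -->
    derivnI Line k.+1 f x.
Proof.
move=> sf Ix; have /= := derivnI_cvg (k := k) (x := x) sf I.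
apply: cvg_trans; apply: cvg_app => P /= xP.
by apply: (filterS (F := nbhs x) _ xP) => y yP xy _; exact: (yP).
Qed.

Lemma derivnI_half f k x : smooth Line f -> dom HalfLine x ->
  derivnI HalfLine k f x = derivnI Line k f x.
Proof.
move=> sf; elim: k x => // k IHk x Ix; apply: lim_diffq => //.
apply: eq_diffq_cvg (derivnI_half_cvg (k := k) sf Ix) => // y Iy.
exact: esym (IHk y Iy).
Qed.

Lemma BI_half f : BI Line f -> BI HalfLine f.
Proof.
move=> [sf bf]; split=> k.
  move=> x Ix; apply/cvg_ex; exists (derivnI Line k.+1 f x).
  apply: eq_diffq_cvg (derivnI_half_cvg (k := k) sf Ix) => // y Iy.
  by rewrite derivnI_half.
have [M [Mr MP]] := bf k; exists M; split=> // K MK x Ix /=.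
by rewrite derivnI_half//; exact: MP.
Qed.

Lemma lebesgue_measureT_gt0 : (0 < @lebesgue_measure R setT)%E.
Proof. by rewrite -set_itvNyy lebesgue_measure_itv/= lt0y. Qed.

Lemma LinfD I I1 I2 f g h :
  (forall x, dom I x -> [/\ dom I1 x, dom I2 x &
    Normc.normc (f x) <= Normc.normc (g x) + Normc.normc (h x)]) ->
  (Linf I f <= Linf I1 g + Linf I2 h)%E.
Proof.
move=> fgh; rewrite /Linf unlock lebesgue_measureT_gt0.
apply: le_trans (ess_supD _ _ _); apply: le_ess_sup; apply: nearW => x /=.
rewrite /patch; case: ifPn => [|_]; last by rewrite abse0 adde_ge0// abse_ge0.
rewrite inE => /fgh[I1x I2x le]; rewrite !mem_set//= -EFinD lee_fin.
have n0 (z : R[i]) : 0 <= Normc.normc z by case: z => a b; exact: sqrtr_ge0.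
by rewrite !ger0_norm.
Qed.

Lemma Linf_ge0 I f : (0 <= Linf I f)%E.
Proof. exact: Lnorm_ge0. Qed.

Lemma seminormB I k f g : smooth I f -> smooth I g ->
  (seminorm I k (f - g)%R <= seminorm I k f + seminorm I k g)%E.
Proof.
move=> sf sg; rewrite /seminorm -big_split/=; apply: lee_sum => j _.
apply: LinfD => x Ix; split=> //; rewrite derivnIB//.
by rewrite (le_trans (le_normcD _ _))// normcN.
Qed.

Lemma seminorm0 I k : seminorm I k (0 : R -> R[i]) = 0%E.
Proof.
rewrite /seminorm big1// => j _; rewrite /Linf.
rewrite (_ : _ \_ _ = cst 0%E) ?Lnorm0//; apply/funext => x.
rewrite /patch; case: ifPn => // /set_mem Ix.
by rewrite derivnI0// Normc.normc0.
Qed.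

Lemma seminorm_half k f : smooth Line f ->
  (seminorm HalfLine k f <= seminorm Line k f)%E.
Proof.
move=> sf; apply: lee_sum => j _; rewrite -[leRHS]adde0.
have <- : Linf Line (0 : R -> R[i]) = 0%E.
  by have := seminorm0 Line 0; rewrite /seminorm big_ord1.
apply: LinfD => x Ix; split=> //; rewrite derivnI_half//.
by rewrite Normc.normc0 addr0.
Qed.

Lemma null_zmod_closed I : zmod_closed (mem (null I (@BI R I))).
Proof.
split=> [|u v]; rewrite !inE.
  split=> [e _|k m]; first exact: BI0.
  by exists 0; apply: nearW => e; rewrite seminorm0 mul0r.
move=> [uB Nu] [vB Nv]; split=> [e e01|k m].
  by apply: BIB; [exact: uB|exact: vB].
have [K1 K1P] := Nu k m; have [K2 K2P] := Nv k m; exists (K1 + K2).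
near=> e.
have e01 : 0 < e <= 1.
  by apply/andP; split; near: e; [exact: nbhs_right_gt|exact: nbhs_right_le].
apply: (le_trans (seminormB _ (uB e e01).1 (vB e e01).1)).
by rewrite mulrDl EFinD leeD//; near: e.
Unshelve. all: by end_near. Qed.

Lemma null_half : null Line (@BI R Line) `<=` null HalfLine (@BI R HalfLine).
Proof.
move=> u [uB Nu]; split=> [e e01|k m]; first exact/BI_half/uB.
have [K KP] := Nu k m; exists K; near=> e.
have e01 : 0 < e <= 1.
  by apply/andP; split; near: e; [exact: nbhs_right_gt|exact: nbhs_right_le].
apply: (le_trans (seminorm_half _ (uB e e01).1)).
by near: e.
Unshelve. all: by end_near. Qed.

End closure.

Definition nullB (R : realType) (I : domain) : {pred net R} :=
  mem (null I (@BI R I)).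

HB.instance Definition _ (R : realType) (I : domain) :=
  GRing.isZmodClosed.Build (net R) (nullB I) (@null_zmod_closed R I).

(* For X included in BI I one has null I X = moderate I X `&` null I (BI I) by
   null_sub, so that moderate I X / null I X embeds in
   moderate I (BI I) / null I (BI I): it is the set of the classes, modulo
   null I (BI I), of the elements of moderate I X. All these classes live in
   the group of all nets modulo null I (BI I). *)
Notation net_quot R I := {ideal_quot (@nullB R I)}.

Definition class_of (R : realType) (I : domain) (u : net R) : net_quot R I :=
  \pi u.
Arguments class_of {R} I u.

Lemma class_ofE (R : realType) (I : domain) (u v : net R) :
  class_of I u = class_of I v <-> null I (@BI R I) (u - v).
Proof.
have -> : null I (@BI R I) (u - v) <-> u - v \in @nullB R I by rewrite inE.
by rewrite Quotient.idealrBE; split=> /eqP.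
Qed.

Definition G (R : realType) (I : domain) (X : set (R -> R[i])) :
  set (net_quot R I) := [set class_of I u | u in moderate I X].
Arguments G {R} I X.

Definition Gaaa (R : realType) : set (net_quot R Line) := G Line (@Baaa R).

Definition Gaa (R : realType) : set (net_quot R Line) := G Line (@Baa R).

Definition G0 (R : realType) : set (net_quot R Line) := G Line (@B0 R).

Definition restrJ (R : realType) (u : net_quot R Line) : net_quot R HalfLine :=
  class_of HalfLine (repr u).

Lemma restrJE (R : realType) (u : net R) :
  restrJ (class_of Line u) = class_of HalfLine u.
Proof. by apply/class_ofE/null_half/class_ofE; rewrite /class_of reprK. Qed.

Lemma restrJ_GB (R : realType) (u : net_quot R Line) :
  G Line (@BI R Line) u -> G HalfLine (@BI R HalfLine) (restrJ u).
Proof.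
move=> [v [vB Mv] <-]; exists v; last by rewrite restrJE.
split=> [e e01|k]; first exact/BI_half/vB.
have [m [K KP]] := Mv k; exists m, K; near=> e.
have e01 : 0 < e <= 1.
  by apply/andP; split; near: e; [exact: nbhs_right_gt|exact: nbhs_right_le].
apply: (le_trans (seminorm_half _ (vB e e01).1)).
by near: e.
Unshelve. all: by end_near. Qed.

(* Main.v *)
Require Import Defs.
From mathcomp Require Import all_boot all_order all_algebra.
From mathcomp Require Import ring_quotient.
From mathcomp Require Import all_classical all_reals all_analysis.
From mathcomp Require Import complex.
From mathcomp Require Import ess_sup_inf ring.

Set Implicit Arguments.
Unset Strict Implicit.
Unset Printing Implicit Defensive.

Import Order.TTheory GRing.Theory Num.Theory.
Import numFieldNormedType.Exports.

Local Open Scope classical_set_scope.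
Local Open Scope ring_scope.
Local Open Scope complex_scope.

(* If g is almost automorphic and f - g tends to 0 at +oo, then translating
   along (a subsequence of) the integers and back bounds |g| on R by the
   supremum of |f| on [0, +oo[. Applied to derivatives, this bounds the
   seminorms on R of the almost automorphic part of a function by the
   seminorms of that function on [0, +oo[, which gives both the moderateness
   of the decomposition and its uniqueness. The decomposition of a smooth f is
   taken epsilon by epsilon: if g_k is the almost automorphic part of f^(k),
   the same bound applied to g_k (x + t) - g_k x - t g_(k+1) x, with the Taylor
   estimate for f, shows that g_k' = g_(k+1); and f - g_0 serves as the
   vanishing part on the whole line. *)

Local Notation normc := Normc.normc.

(** * Modulus and topology of the complex numbers *)

Section modulus.
Variable R : realType.
Implicit Types (z l : R[i]) (M : R).

Lemma le_normc_distD z l : normc z <= normc l + normc (z - l).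
Proof. by rewrite -{1}(subrKC l z) le_normcD. Qed.

Lemma normcBC z l : normc (z - l) = normc (l - z).
Proof. by rewrite -(normcN (l - z)) opprB. Qed.

Lemma normc_re M : normc M%:C = `|M|.
Proof. by rewrite /= expr0n addr0 sqrtr_sqr. Qed.

Lemma normc_ge_absRe z : `|complex.Re z| <= normc z.
Proof. by have := normc_ge_Re z; rewrite lecR. Qed.

Lemma normc_ge_absIm z : `|complex.Im z| <= normc z.
Proof. by case: z => a b /=; rewrite -sqrtr_sqr ler_wsqrtr// lerDr sqr_ge0. Qed.

Lemma normc_le_absReIm z : normc z <= `|complex.Re z| + `|complex.Im z|.
Proof.
case: z => a b /=; rewrite -[leRHS]ger0_norm ?addr_ge0// -sqrtr_sqr.
rewrite ler_wsqrtr// sqrrD !real_normK ?num_real// lerD2r lerDl.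
by rewrite mulrn_wge0 ?mulr_ge0.
Qed.

(** A positive element of [R[i]] has zero imaginary part, so real radii suffice to test
    convergence. *)
Lemma cvg_normcP T (F : set_system T) (f : T -> R[i]) l : Filter F ->
  f @ F --> l <-> forall e : R, 0 < e -> \forall x \near F, normc (l - f x) < e.
Proof.
move=> FF; split=> [/cvgrPdist_lt fl e e0|fl].
  have := fl e%:C; rewrite ltcR => /(_ e0); apply: filterS => x.
  by rewrite ltcR.
apply/cvgrPdist_lt => -[e i]; rewrite ltcE/= => /andP[/eqP -> e0].
by apply: filterS (fl _ e0) => x; rewrite -ltcR.
Qed.

Lemma normc_cvg_le T (F : set_system T) (f : T -> R[i]) l M :
  ProperFilter F -> f @ F --> l -> (\forall x \near F, normc (f x) <= M) ->
  normc l <= M.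
Proof.
move=> FF /cvg_normcP fl fM; apply/ler_addgt0Pr => e /fl {}fl.
have [x [xM xl]] := filter_ex (filterI fM fl).
by rewrite (le_trans (le_normc_distD l (f x)))// lerD// ltW.
Qed.

Lemma bounded_normc (f : R -> R[i]) :
  [bounded f x | x in setT] <-> exists M : R, forall x, normc (f x) <= M.
Proof.
have gF : ProperFilter (globally [set: R]).
  exact: (@globally_properfilter _ _ 0).
split=> [/ex_bound[[M i] /= fM]|[M fM]].
  by exists M => x; have := fM x I; rewrite lecE => /andP[].
by apply/ex_bound; exists M%:C => x _ /=; rewrite lecR.
Qed.

End modulus.

(** * Difference quotients as first-order expansions *)

Section diffq.
Variable R : realType.
Implicit Types (f : R -> R[i]) (x t : R) (l : R[i]).

(** Multiplying by the increment clears the division; at [t = 0] both sides of the estimate vanish,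
    so the centre need not be excluded. *)
Lemma diffq_cvgP f x l :
  diffq f x y @[y --> within (dom Line) x^'] --> l <->
  forall e : R, 0 < e -> exists2 d, 0 < d & forall t, `|t| < d ->
    normc (f (x + t) - f x - t%:C * l) <= e * `|t|.
Proof.
have E y : y != x -> l - diffq f x y =
    - ((y - x)%:C^-1 * (f y - f x - (y - x)%:C * l)).
  move=> yx; have yx0 : (y - x)%:C != 0 :> R[i].
    by rewrite fmorph_eq0 subr_eq0.
  by rewrite mulrBr mulKf// opprB mulrC.
have N y : y != x -> normc (l - diffq f x y) =
    `|y - x|^-1 * normc (f y - f x - (y - x)%:C * l).
  by move=> yx; rewrite E// normcN Normc.normcM Normc.normcV normc_re.
split=> [/cvg_normcP fl e /fl /nbhs_ballP[d d0 dfl]|fl].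
  exists d => // t td; have [->|t0] := eqVneq t 0.
    by rewrite addr0 subrr mul0r subrr Normc.normc0 normr0 mulr0.
  have tx : x + t != x by rewrite -subr_eq0 addrAC subrr add0r.
  have := dfl (x + t); rewrite /ball/= opprD addNKr normrN => /(_ td tx I).
  rewrite N// addrAC subrr add0r mulrC ltr_pdivrMr ?normr_gt0//.
  exact: ltW.
(* Halving [e] turns the non-strict estimate into the strict one required for convergence. *)
apply/cvg_normcP => e e0; have e20 : 0 < e / 2 by rewrite divr_gt0.
have [d d0 dfl] := fl _ e20.
apply/nbhs_ballP; exists d => // y; rewrite /ball/= distrC => yd yx _.
rewrite N// mulrC ltr_pdivrMr ?normr_gt0 ?subr_eq0//.
have := dfl _ yd; rewrite subrKC => /le_lt_trans; apply.
by rewrite ltr_pM2r ?normr_gt0 ?subr_eq0// ltr_pdivrMr// ltr_pMr// ltr1n.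
Qed.

Lemma diffq_continuous f x l :
  diffq f x y @[y --> within (dom Line) x^'] --> l -> {for x, continuous f}.
Proof.
move=> /diffq_cvgP/(_ _ ltr01)[d d0 dfl]; apply/cvg_normcP => e e0.
have L0 : 0 < 1 + normc l by rewrite ltr_wpDr// (le_trans _ (normc_ge_absRe l)).
(* The expansion with error at most [|t|] gives [normc (f (x + t) - f x) <= (1 + normc l) * |t|],
   whence this radius. *)
apply/nbhs_ballP; exists (Num.min d (e / (1 + normc l))).
  by rewrite /= lt_min d0 divr_gt0.
move=> y; rewrite /ball/= distrC lt_min ltr_pdivlMr// => /andP[/dfl + ye].
rewrite subrKC mul1r normcBC => ydl; apply: le_lt_trans ye.
rewrite (le_trans (le_normc_distD _ ((y - x)%:C * l)))// Normc.normcM normc_re.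
by rewrite mulrDr mulr1 addrC lerD2r.
Qed.

(** [p] stands for the real or the imaginary part: it carries complex difference quotients to real
    derivatives, to which the mean value theorem applies. *)
Lemma diffq_is_derive (p : R[i] -> R) f x l :
  (forall z w, p (z - w) = p z - p w) -> (forall t z, p (t%:C * z) = t * p z) ->
  (forall z, `|p z| <= normc z) ->
  diffq f x y @[y --> within (dom Line) x^'] --> l ->
  is_derive x 1 (p \o f) (p l).
Proof.
move=> pB pM pn fl.
have pfl : h^-1 *: ((p \o f) (h *: 1 + x) - (p \o f) x) @[h --> 0^'] --> p l.
  apply/cvgrPdist_le => e e0; have /diffq_cvgP/(_ _ e0)[d d0 dfl] := fl.
  apply/nbhs_ballP; exists d => // h; rewrite /ball/= sub0r normrN => hd h0.
  rewrite [_ *: 1]mulr1 [h + x]addrC /= -pB.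
  have -> : p l - h^-1 *: p (f (x + h) - f x) =
      - (h^-1 * p (f (x + h) - f x - h%:C * l)).
    by rewrite [in RHS]pB pM mulrBr mulKf// opprB.
  rewrite normrN normrM normfV mulrC ler_pdivrMr ?normr_gt0//.
  exact: le_trans (pn _) (dfl _ hd).
have dpf : derivable (p \o f) x 1 by apply/cvg_ex; exists (p l).
by apply: DeriveDef => //; apply: cvg_lim.
Qed.

End diffq.

(** * First-order Taylor estimates *)

Section taylor.
Variable R : realType.

(** [a] and [b] come in either order, so that increments of both signs are covered. *)
Lemma MVT_dist (f df : R -> R) (a b : R) :
  (forall x : R, is_derive x 1 f (df x)) ->
  exists2 c, `|c - a| <= `|b - a| & f b - f a = df c * (b - a).
Proof.
move=> fdf; have cf : continuous f.
  move=> x; apply: differentiable_continuous; apply/derivable1_diffP.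
  by case: (fdf x).
have [ab|/ltW ba] := leP a b.
  have [c cab ->] := MVT_segment ab (fun x _ => fdf x) (continuous_subspaceT cf).
  exists c => //; move: cab; rewrite in_itv/= => /andP[ac cb].
  by rewrite !ger0_norm ?subr_ge0// lerB.
have [c cab fba] := MVT_segment ba (fun x _ => fdf x) (continuous_subspaceT cf).
exists c; last by rewrite -opprB fba -mulrN opprB.
move: cab; rewrite in_itv/= => /andP[bc ca].
by rewrite distrC [leRHS]distrC !ger0_norm ?subr_ge0// lerB.
Qed.

(** The mean value theorem is applied to [f], then to [df] between [x] and the intermediate point,
    which lies within [|t|] of [x]. *)
Lemma taylor1_le (f df ddf : R -> R) (M x t : R) :
  (forall x : R, is_derive x 1 f (df x)) ->
  (forall x : R, is_derive x 1 df (ddf x)) ->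
  (forall x, `|ddf x| <= M) -> `|f (x + t) - f x - t * df x| <= M * t ^+ 2.
Proof.
move=> fdf dfddf ddfM.
have [c] := MVT_dist x (x + t) fdf; rewrite [x + t]addrC addrK => cx ->.
have [c' _ dfc] := MVT_dist x c dfddf.
rewrite [t * _]mulrC -mulrBl dfc !normrM -[t ^+ 2]real_normK ?num_real//.
by rewrite expr2 mulrA ler_wpM2r// ler_pM.
Qed.

(** The mean value theorem fails for complex values, so real and imaginary parts are estimated
    separately; each contributes one [M]. *)
Lemma taylor1_normc_le (f df ddf : R -> R[i]) (M x t : R) :
  (forall x, diffq f x y @[y --> within (dom Line) x^'] --> df x) ->
  (forall x, diffq df x y @[y --> within (dom Line) x^'] --> ddf x) ->
  (forall x, normc (ddf x) <= M) ->
  normc (f (x + t) - f x - t%:C * df x) <= (M + M) * t ^+ 2.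
Proof.
move=> fdf dfddf ddfM.
have taylor (p : R[i] -> R) : (forall z w, p (z - w) = p z - p w) ->
    (forall t z, p (t%:C * z) = t * p z) -> (forall z, `|p z| <= normc z) ->
    `|p (f (x + t) - f x - t%:C * df x)| <= M * t ^+ 2.
  move=> pB pM pn; rewrite !pB pM.
  apply: (taylor1_le (f := p \o f) (df := p \o df) (ddf := p \o ddf)) => y.
  - exact: diffq_is_derive.
  - exact: diffq_is_derive.
  - exact: le_trans (pn _) (ddfM _).
rewrite mulrDl (le_trans (normc_le_absReIm _))// lerD// taylor//.
- by move=> [? ?] [? ?].
- by move=> s [a b]/=; rewrite mul0r subr0.
- exact: normc_ge_absRe.
- by move=> [? ?] [? ?].
- by move=> s [a b]/=; rewrite mul0r addr0.
- exact: normc_ge_absIm.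
Qed.

End taylor.

(** * Almost automorphic functions and essential suprema *)

Section Caa.
Variable R : realType.
Implicit Types (f g h : R -> R[i]) (s : nat -> R).

Lemma homo_lt_cvg_infty (phi : nat -> nat) :
  {homo phi : i j / (i < j)%N} -> phi k @[k --> \oo] --> \oo.
Proof.
move=> phiS; have le k : (k <= phi k)%N.
  by elim: k => // k IHk; exact: leq_ltn_trans IHk (phiS _ _ (ltnSn k)).
move=> P [N _ NP]; exists N => // k /= Nk; apply: NP.
exact: leq_trans Nk (le k).
Qed.

(** A subsequence that suits [g1] is refined to one that also suits [g2]; the limits for [g1]
    survive the refinement. *)
Lemma Caa_pair g1 g2 s : Caa g1 -> Caa g2 ->
  exists (phi : nat -> nat) (h1 h2 : R -> R[i]),
    {homo phi : i j / (i < j)%N} /\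
    [/\ forall x, g1 (x + s (phi k)) @[k --> \oo] --> h1 x,
        forall x, h1 (x - s (phi k)) @[k --> \oo] --> g1 x,
        forall x, g2 (x + s (phi k)) @[k --> \oo] --> h2 x &
        forall x, h2 (x - s (phi k)) @[k --> \oo] --> g2 x].
Proof.
move=> [_ ga1] [_ ga2]; have [phi [h1 [phiS gh1 hg1]]] := ga1 s.
have [psi [h2 [psiS gh2 hg2]]] := ga2 (s \o phi).
exists (phi \o psi), h1, h2; split; first by move=> i j /psiS/phiS.
have psioo := homo_lt_cvg_infty psiS.
split=> x.
- exact: (cvg_comp psi (fun k => g1 (x + s (phi k)))) psioo (gh1 x).
- exact: (cvg_comp psi (fun k => h1 (x - s (phi k)))) psioo (hg1 x).
- exact: gh2.
- exact: hg2.
Qed.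

Lemma CaaB g1 g2 : Caa g1 -> Caa g2 -> Caa (g1 \- g2).
Proof.
move=> ag1 ag2; split=> [|s].
  move=> x; apply: cvgB; [exact: ag1.1|exact: ag2.1].
have [phi [h1 [h2 [phiS [gh1 hg1 gh2 hg2]]]]] := Caa_pair s ag1 ag2.
exists phi, (h1 \- h2); split=> [//|x|x]; apply: cvgB.
- exact: gh1.
- exact: gh2.
- exact: hg1.
- exact: hg2.
Qed.

Lemma CaaZ (a : R[i]) g : Caa g -> Caa (fun x => a * g x).
Proof.
move=> [cg ag]; split=> [x|s]; first by apply: cvgMr; exact: cg.
have [phi [h [phiS gh hg]]] := ag s.
exists phi, (fun x => a * h x); split=> [//|x|x]; apply: cvgMr.
- exact: gh.
- exact: hg.
Qed.

Lemma Caa_shift t g : Caa g -> Caa (fun x => g (x + t)).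
Proof.
move=> [cg ag]; split=> [x|s].
  apply: (cvg_comp (fun x => x + t) g); last exact: cg.
  by apply: cvgD; [exact: cvg_id|exact: cvg_cst].
have [phi [h [phiS gh hg]]] := ag s.
exists phi, (fun x => h (x + t)); split=> [//|x|x].
- by under eq_fun do rewrite addrAC; exact: gh.
- by under eq_fun do rewrite addrAC; exact: hg.
Qed.

(** If [g] were unbounded, take [s n] with [n < normc (g (s n))]: along a subsequence the values
    [g (s n)] would converge while their moduli tend to infinity. *)
Lemma Caa_bounded g : Caa g -> exists M : R, forall x, normc (g x) <= M.
Proof.
move=> [_ ag]; apply: contrapT => /forallNP gM.
have {}gM (n : nat) : exists x, n%:R < normc (g x).
  by have /existsNP[x /negP] := gM n%:R; rewrite -ltNge; exists x.
have [s sM] := choice gM; have [phi [h [phiS /(_ 0) + _]]] := ag s.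
move=> /cvg_normcP/(_ _ ltr01) gh.
have phioo := homo_lt_cvg_infty phiS (nbhs_infty_gtr (normc (h 0) + 1)).
have [N _ HN] := filterI gh phioo.
have [/= {}gh] := HN N (leqnn N); rewrite add0r in gh.
rewrite ltNge => /negP; apply.
apply/ltW/(lt_le_trans (sM _)); rewrite (le_trans (le_normc_distD _ (h 0)))//.
by rewrite lerD2l normcBC ltW.
Qed.

Lemma cvg_pinfty_addl (x : R) (u : nat -> R) :
  u k @[k --> \oo] --> +oo -> x + u k @[k --> \oo] --> +oo.
Proof.
move=> /cvgryPge uoo; apply/cvgryPge => A.
by apply: filterS (uoo (A - x)) => k; rewrite lerBlDl.
Qed.

(* Along s_m = m the translates of f and g have the same limits. *)
Lemma Caa_bound f g (M : R) : Caa g -> f x - g x @[x --> +oo] --> (0 : R[i]) ->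
  (forall x, 0 <= x -> normc (f x) <= M) -> forall x, normc (g x) <= M.
Proof.
move=> [_ ag] fg fM; have [phi [h [phiS gh hg]]] := ag (fun k => k%:R).
have xphi (x : R) : x + (phi k)%:R @[k --> \oo] --> +oo.
  apply: (@cvg_pinfty_addl x (fun k => (phi k)%:R)).
  exact: (cvg_comp phi (fun k => k%:R : R)) (homo_lt_cvg_infty phiS) cvgr_idn.
have hM x : normc (h x) <= M.
  have fgx : f (x + (phi k)%:R) - g (x + (phi k)%:R) @[k --> \oo] --> (0 : R[i]).
    exact: cvg_comp (xphi x) fg.
  have fh : f (x + (phi k)%:R) @[k --> \oo] --> h x.
    rewrite -[h x]add0r.
    rewrite (_ : (fun k => f _) = (fun k => f (x + (phi k)%:R) -
        g (x + (phi k)%:R) + g (x + (phi k)%:R))).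
      exact: cvgD fgx (gh x).
    by apply/funext => k; rewrite subrK.
  have fM' : \forall k \near \oo, normc (f (x + (phi k)%:R)) <= M.
    by have /cvgryPge/(_ 0) := xphi x; apply: filterS => k; exact: fM.
  exact: normc_cvg_le fh fM'.
move=> x; have hM' : \forall k \near \oo, normc (h (x - (phi k)%:R)) <= M.
  by apply: nearW => k; exact: hM.
exact: normc_cvg_le (hg x) hM'.
Qed.

Lemma Linf_le (I : domain) f (M : R) : 0 <= M ->
  (forall x, dom I x -> normc (f x) <= M) -> (Linf I f <= M%:E)%E.
Proof.
move=> M0 fM; rewrite /Linf unlock lebesgue_measureT_gt0.
apply/ess_supP; apply: nearW => x /=; rewrite /patch.
case: ifPn => [/set_mem/fM xM|_]; last by rewrite abse0 lee_fin.
by rewrite /= lee_fin ger0_norm// (le_trans _ (normc_ge_absRe _)).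
Qed.

(** By continuity, exceeding [M] at one point means exceeding it on an interval of positive
    measure. *)
Lemma normc_le_Linf_half f (M : R) :
  continuous f -> (Linf HalfLine f <= M%:E)%E ->
  forall x, 0 <= x -> normc (f x) <= M.
Proof.
move=> cf; rewrite /Linf unlock lebesgue_measureT_gt0 => /ess_supP[A [mA A0 fA]].
move=> x x0; rewrite leNgt; apply/negP => Mf.
have /cvg_normcP/(_ (normc (f x) - M)) := cf x.
rewrite subr_gt0 => /(_ Mf)/nbhs_ballP[d/= d0 xd].
(* Taken to the right of [x], the interval stays in the half-line even when [x = 0], so it lies in
   the null set [A]. *)
have : (@lebesgue_measure R `]x, (x + d)%R[%classic <= @lebesgue_measure R A)%E.
  apply: le_measure; rewrite ?inE// => y; rewrite /= in_itv/= => /andP[xy yxd].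
  apply: fA => /=; rewrite /patch mem_set/= ?in_itv/= ?andbT; last first.
    exact/ltW/(le_lt_trans x0).
  apply/negP; rewrite lee_fin -ltNge ger0_norm; last first.
    by rewrite (le_trans _ (normc_ge_absRe _)).
  have := xd y; rewrite /ball/= distrC ger0_norm ?subr_ge0 ?ltW// ltrBlDl.
  move=> /(_ yxd) fxy; rewrite -(ltrD2r (normc (f x - f y))).
  apply: lt_le_trans (le_normc_distD (f x) (f y)).
  by rewrite addrC -ltrBrDr.
rewrite A0 lebesgue_measure_itv/= lte_fin ltrDl d0 -EFinB addrAC subrr add0r.
by rewrite lee_fin leNgt d0.
Qed.

Lemma Linf_Caa_le f g : continuous f -> Caa g ->
  f x - g x @[x --> +oo] --> (0 : R[i]) -> (Linf Line g <= Linf HalfLine f)%E.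
Proof.
move=> cf ag fg; have := Linf_ge0 HalfLine f.
(* An infinite norm makes the bound trivial, and [-oo] is excluded by nonnegativity. *)
case E : (Linf HalfLine f) => [M| |]// M0; last exact: leey.
apply: Linf_le => // x _; apply: (Caa_bound ag fg).
by apply: normc_le_Linf_half => //; rewrite E.
Qed.

End Caa.

(** * Decomposition of a single smooth function *)

Section decomposition.
Variable R : realType.
Implicit Types (f g h : R -> R[i]).

Lemma cvg0B T (F : set_system T) (f g : T -> R[i]) : Filter F ->
  f @ F --> 0 -> g @ F --> 0 -> f x - g x @[x --> F] --> (0 : R[i]).
Proof. by move=> FF f0 g0; rewrite -[X in _ --> X](subr0 0); exact: cvgB. Qed.

(** For fixed [t] the remainder of [g] is almost automorphic in [x], so its bound holds at every
    real [x] and not only near [+oo]; being quadratic in [t], it yields differentiability. *)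
Lemma diffq_Caa (f df ddf g dg : R -> R[i]) :
  (forall x, diffq f x y @[y --> within (dom Line) x^'] --> df x) ->
  (forall x, diffq df x y @[y --> within (dom Line) x^'] --> ddf x) ->
  (exists M : R, forall x, normc (ddf x) <= M) ->
  Caa g -> Caa dg ->
  f x - g x @[x --> +oo] --> (0 : R[i]) ->
  df x - dg x @[x --> +oo] --> (0 : R[i]) ->
  forall x, diffq g x y @[y --> within (dom Line) x^'] --> dg x.
Proof.
move=> fdf dfddf [M ddfM] ag adg fg dfdg.
have M0 : 0 <= M.
  by rewrite (le_trans _ (ddfM 0))// (le_trans _ (normc_ge_absRe _)).
have gle t : forall x, normc (g (x + t) - g x - t%:C * dg x) <= (M + M) * t ^+ 2.
  have aD : Caa ((fun x => g (x + t)) \- g \- (fun x => t%:C * dg x)).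
    exact: CaaB (CaaB (Caa_shift t ag) ag) (CaaZ t%:C adg).
  have ft : f (x + t) - g (x + t) @[x --> +oo] --> (0 : R[i]).
    apply: (cvg_comp (fun x => x + t) (fun x => f x - g x)) fg.
    exact: cvg_addrr.
  have D0 : (f (x + t) - g (x + t)) - (f x - g x) - t%:C * (df x - dg x)
      @[x --> +oo] --> (0 : R[i]).
    have F0 : Filter (pinfty_nbhs R) by exact: proper_pinfty_nbhs.
    apply: (cvg0B F0 (cvg0B F0 ft fg)).
    by rewrite -[X in _ --> X](mulr0 t%:C); exact: cvgMr.
  apply: (Caa_bound aD (f := fun x => f (x + t) - f x - t%:C * df x)).
    apply: cvg_trans D0; apply: near_eq_cvg; apply: nearW => x /=.
    ring.
  by move=> x _; exact: taylor1_normc_le x t fdf dfddf ddfM.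
move=> x; apply/diffq_cvgP => e e0.
have MM : 0 < M + M + 1 by rewrite ltr_wpDl// addr_ge0.
(* With this radius [(M + M) * |t| <= e]; the added 1 keeps the divisor positive when [M = 0]. *)
exists (e / (M + M + 1)); first by rewrite divr_gt0.
move=> t; rewrite ltr_pdivlMr// => te; rewrite (le_trans (gle t x))//.
rewrite -[t ^+ 2]real_normK ?num_real// expr2 mulrA ler_wpM2r//.
by rewrite (le_trans _ (ltW te))// mulrC ler_wpM2l// lerDl.
Qed.

Lemma smooth_continuous f k : smooth Line f -> continuous (derivnI Line k f).
Proof. by move=> sf x; exact: diffq_continuous (derivnI_cvg (k := k) sf I). Qed.

Lemma Baa_BI f : Baa f -> BI Line f.
Proof.
by move=> [sf af]; split=> // k; apply/bounded_normc; exact: Caa_bounded.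
Qed.

Lemma Baaa_BI f : Baaa f -> BI Line f.
Proof. by move=> [sf af]; split=> // k; have [[]] := af k. Qed.

Lemma BaaB f g : Baa f -> Baa g -> Baa (f - g).
Proof.
move=> [sf af] [sg ag]; split=> [|k]; first exact: smoothB.
rewrite (_ : derivnI _ _ _ = derivnI Line k f \- derivnI Line k g).
  exact: CaaB.
by apply/funext => x; rewrite derivnIB.
Qed.

Lemma B0B f g : B0 f -> B0 g -> B0 (f - g).
Proof.
move=> [bf f0] [bg g0]; split=> [|k]; first exact: BIB.
rewrite (_ : derivnI _ _ _ = derivnI Line k f \- derivnI Line k g).
  exact: (@cvg0B _ _ _ _ (@proper_pinfty_nbhs R) (f0 k) (g0 k)).
by apply/funext => x; rewrite derivnIB//; [exact: bf.1|exact: bg.1].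
Qed.

Lemma Baaa_decomposition f : Baaa f -> exists g, Baa g /\ B0 (f - g).
Proof.
move=> aaaf; have [sf af] := aaaf.
(* The parts of the successive derivatives are chosen independently of each other. The given
   splitting holds on the half-line only, so just its limit at [+oo] is kept. *)
have /choice[g gP] (k : nat) : exists g, Caa g /\
    derivnI Line k f x - g x @[x --> +oo] --> (0 : R[i]).
  have [_ [g [h [ag [_ h0] fgh]]]] := af k; exists g; split=> //.
  apply: cvg_trans h0; apply: near_eq_cvg; near=> x.
  rewrite fgh /=; first by rewrite [g x + _]addrC addrK.
  by rewrite in_itv/= andbT; near: x; exact: nbhs_pinfty_ge.
(* The independent choices fit together; the Taylor bound uses that the derivative of order [k.+2]
   is bounded. *)
have dg k x : diffq (g k) x y @[y --> within (dom Line) x^'] --> g k.+1 x.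
  have [a1 l1] := gP k; have [a2 l2] := gP k.+1.
  apply: (diffq_Caa (ddf := derivnI Line k.+2 f) _ _ _ a1 a2 l1 l2).
  - by move=> y; exact: derivnI_cvg.
  - by move=> y; exact: derivnI_cvg.
  - by apply/bounded_normc; exact: (Baaa_BI aaaf).2.
have dgE k : derivnI Line k (g 0%N) = g k.
  elim: k => // k IHk; apply/funext => x /=.
  by rewrite -/(derivnI Line k (g 0%N)) IHk; apply: lim_diffq.
have ag : Baa (g 0%N).
  split=> k; last by rewrite dgE; have [] := gP k.
  by move=> x _; apply/cvg_ex; exists (g k.+1 x); rewrite dgE.
exists (g 0%N); split; first exact: ag.
split=> [|k]; first exact: BIB (Baaa_BI aaaf) (Baa_BI ag).
rewrite (_ : derivnI _ _ _ = fun x => derivnI Line k f x - g k x).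
  by have [] := gP k.
apply/funext => x; have <- := dgE k.
exact: (derivnIB k sf ag.1 (x := x) I).
Unshelve. all: by end_near. Qed.

(** Serves twice: for moderateness [f] is a member of the given net, for uniqueness it is a
    difference of two decomposed sums. *)
Lemma seminorm_Baa_le f g k : Baa g -> smooth Line f -> B0 (f - g) ->
  (seminorm Line k g <= seminorm HalfLine k f)%E.
Proof.
move=> [sg ag] sf [_ fg0]; apply: lee_sum => j _.
rewrite (_ : Linf HalfLine _ = Linf HalfLine (derivnI Line j f)); last first.
  rewrite /Linf; congr (Lnorm _ _ _); apply/funext => x; rewrite /patch.
  by case: ifPn => // /set_mem x0; rewrite derivnI_half.
apply: Linf_Caa_le => //; first exact: smooth_continuous.
have := fg0 j; rewrite (_ : derivnI Line j (f - g) =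
  fun x => derivnI Line j f x - derivnI Line j g x)//.
by apply/funext => x; rewrite derivnIB.
Qed.

(** * Nets and their classes *)

Lemma near_unit_itv (P : R -> Prop) : (forall e, 0 < e <= 1 -> P e) ->
  \forall e \near (0 : R)^'+, P e.
Proof.
move=> HP; near=> e; apply: HP.
by apply/andP; split; near: e; [exact: nbhs_right_gt|exact: nbhs_right_le].
Unshelve. all: by end_near. Qed.

Lemma class_ofD I (u v : net R) :
  class_of I (u + v) = class_of I u + class_of I v.
Proof. exact: (@Quotient.pi_add _ (nullB (R := R) I)). Qed.

(** Each [e] is decomposed separately; since the seminorms of [v e] are bounded by those of [u e],
    no uniformity in the choice is required. *)
Lemma moderate_decomposition (u : net R) : moderate Line (@Baaa R) u ->
  exists v, moderate Line (@Baa R) v /\ moderate Line (@B0 R) (u - v).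
Proof.
move=> [uaaa Mu].
have /choice[v vP] (e : R) : exists g, 0 < e <= 1 -> Baa g /\ B0 (u e - g).
  (* Values of a net outside []0, 1]] are irrelevant, so 0 serves there. *)
  have [e01|] := boolP (0 < e <= 1); last by exists 0.
  by have [g gP] := Baaa_decomposition (uaaa e e01); exists g.
have vle k e : 0 < e <= 1 -> (seminorm Line k (v e) <= seminorm Line k (u e))%E.
  move=> e01; have [av w0] := vP e e01; have [su _] := uaaa e e01.
  by apply: le_trans (seminorm_half _ su); exact: seminorm_Baa_le.
exists v; split.
  split=> [e /vP[]//|k]; have [m [K uK]] := Mu k; exists m, K.
  by apply: filterS2 uK (near_unit_itv (vle k)) => e ue /le_trans; exact.
split=> [e /vP[]//|k]; have [m [K uK]] := Mu k; exists m, (K + K).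
apply: filterS2 uK (near_unit_itv (fun e => id)) => e uK e01.
have [[sv _] _] := vP e e01; have [su _] := uaaa e e01.
apply: (le_trans (seminormB _ su sv)); rewrite mulrDl EFinD leeD//.
exact: le_trans (vle _ _ e01) uK.
Qed.

(** Equality on the half-line forces equality of the almost automorphic parts on all of R: [v - v']
    is almost automorphic and differs from the null difference of the sums by [w - w'], which
    vanishes at [+oo]. *)
Lemma class_of_Baa_eq (v v' w w' : net R) :
  nets_in (@Baa R) v -> nets_in (@Baa R) v' ->
  nets_in (@B0 R) w -> nets_in (@B0 R) w' ->
  class_of HalfLine (v + w) = class_of HalfLine (v' + w') ->
  class_of Line v = class_of Line v'.
Proof.
move=> av av' w0 w0' /class_ofE[_ N]; apply/class_ofE; split.
  by move=> e e01; apply: Baa_BI; apply: BaaB; [exact: av|exact: av'].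
move=> k m; have [K KN] := N k m; exists K.
apply: filterS2 KN (near_unit_itv (fun e => id)) => e KN e01.
apply: le_trans KN; have av1 := av e e01; have av1' := av' e e01.
have w1 := w0 e e01; have w1' := w0' e e01.
have E : (v + w - (v' + w')) e = (v e - v' e) + (w e - w' e).
  by rewrite -addrACA -opprD.
have sw := B0B w1 w1'; have sv := BaaB av1 av1'.
apply: seminorm_Baa_le => //.
(* The sum is read as a difference, so that closure of smoothness under subtraction applies. *)
- rewrite E -[w e - _]opprK; apply: smoothB; first exact: sv.1.
  by rewrite opprB; exact: (B0B w1' w1).1.1.
- by rewrite E addrAC subrr add0r.
Qed.

End decomposition.

Theorem theorem3 (R : realType) (u : net_quot R Line) (hu : Gaaa u) :
  exists v w : net_quot R Line,
    [/\ Gaa v, G0 w, restrJ u = restrJ (v + w) &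
      forall v' w' : net_quot R Line,
        Gaa v' -> G0 w' -> restrJ u = restrJ (v' + w') ->
        restrJ v = restrJ v' /\ restrJ w = restrJ w'].
Proof.
case: hu => u0 Mu <-; have [v [Mv Mw]] := moderate_decomposition Mu.
(* With the remainder as second part, the equality holds on the whole line before any
   restriction. *)
have E : class_of Line u0 = class_of Line v + class_of Line (u0 - v).
  by rewrite -class_ofD subrKC.
exists (class_of Line v), (class_of Line (u0 - v)); split.
- by exists v.
- by exists (u0 - v).
- by rewrite E.
move=> _ _ [v' Mv' <-] [w' Mw' <-]; rewrite E -!class_ofD !restrJE => vw.
have vv' := class_of_Baa_eq Mv.1 Mv'.1 Mw.1 Mw'.1 vw.
have rv : class_of HalfLine v = class_of HalfLine v'.
  by rewrite -restrJE vv' restrJE.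
(* Once the almost automorphic parts agree, the vanishing parts agree by cancellation in the
   quotient group. *)
by split=> //; move: vw; rewrite !class_ofD rv => /addrI.
Qed.
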